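(* Let $G\subseteq\mathrm{GL}_n(\mathbb{R})$ be a finite group, with fundamental invariants $\pi_1,\dots,\pi_m$ and Hilbert map $\Pi=(\pi_1,\dots,\pi_m)$, such that all maximal elementary abelian $2$-subgroups of $G$ have order $2$. Then $\Pi(\mathbb{R}^n)$ is generically described by some $g\in\mathbb{R}[\underline{X}]^G$. More precisely, if $|G|=q2^l$ with $q$ odd and $H_1\subseteq H_2\subseteq\dots\subseteq H_l\subseteq G$ are nested subgroups with $|H_i|=2^i$, then one can choose \[g=\prod_{\sigma H_l\in G/H_l}\sigma\left(\mathcal{R}_{H_l}\left(\sum_{i=1}^n\big(X_i-\mathcal{R}_{H_1}(X_i)\big)^2\right)\right).\]
   Context: $\mathbb{R}[\underline{X}]=\mathbb{R}[X_1,\dots,X_n]$, $G$ acts on polynomials by $\sigma h=h^\sigma$, $h^\sigma(x)=h(\sigma^{-1}x)$, and $\mathcal{R}_K(h)=\frac{1}{|K|}\sum_{\sigma\in K}h^\sigma$ for a subgroup $K$; the product over cosets is independent of representatives because its factors are $H_l$-invariant. $I_\Pi$ is the ideal of relations among $\pi_1,\dots,\pi_m$, $V_{\mathbb{R}}(I_\Pi)\subseteq\mathbb{R}^m$ its real zero set, and for $z\in V_{\mathbb{R}}(I_\Pi)$, $\phi_z$ is the homomorphism $\mathbb{R}[\underline{X}]^G=\mathbb{R}[\pi_1,\dots,\pi_m]\to\mathbb{R}$, $p(\pi_1,\dots,\pi_m)\mapsto p(z)$. $\Pi(\mathbb{R}^n)$ is generically described by $g_1,\dots,g_k\in\mathbb{R}[\underline{X}]^G$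 if $\Pi(\mathbb{R}^n)=\{z\in V_{\mathbb{R}}(I_\Pi)\mid\phi_z(g_1)>0,\dots,\phi_z(g_k)>0\}\cup T$ for some set $T$ with $\dim T<\dim\Pi(\mathbb{R}^n)$. *)

(* Defs.v *)
From HB Require Import structures.
From mathcomp Require Import all_boot all_order all_algebra all_fingroup all_solvable.
From mathcomp Require Import mxrepresentation.
From mathcomp Require Import reals.
From mathcomp Require Import mpoly.

Set Implicit Arguments. Unset Strict Implicit. Unset Printing Implicit Defensive.
Import Order.TTheory GRing.Theory Num.Theory.
Local Open Scope ring_scope.

Section Defs.
Variable R : realType.

(* Action of a finite group gT, through a matrix representation rG of G,
   on polynomials:  h^sigma (x) = h (rG(sigma)^-1 x), realised as the linear
   substitution X_i |-> sum_j (rG(sigma)^-1)_{ij} X_j. *)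
Definition mact (gT : finGroupType) (G : {group gT}) (n : nat)
    (rG : mx_representation R G n) (s : gT) (h : {mpoly R[n]}) : {mpoly R[n]} :=
  h \mPo [tuple (\sum_(j < n) (invmx (rG s)) i j *: 'X_j) | i < n].

Definition reynolds (gT : finGroupType) (G : {group gT}) (n : nat)
    (rG : mx_representation R G n) (K : {set gT}) (h : {mpoly R[n]}) : {mpoly R[n]} :=
  (#|K|%:R)^-1 *: \sum_(s in K) mact rG s h.

Definition g_invariant (gT : finGroupType) (G : {group gT}) (n : nat)
    (rG : mx_representation R G n) (h : {mpoly R[n]}) : Prop :=
  forall s, s \in G -> mact rG s h = h.

Definition subst_inv (n m : nat) (pi : 'I_m -> {mpoly R[n]}) (p : {mpoly R[m]})
  : {mpoly R[n]} := p \mPo [tuple pi i | i < m].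

Definition fundamental_invariants (gT : finGroupType) (G : {group gT}) (n m : nat)
    (rG : mx_representation R G n) (pi : 'I_m -> {mpoly R[n]}) : Prop :=
  (forall i, g_invariant rG (pi i)) /\
  (forall i, exists d : nat, pi i \is d.-homog) /\
  (forall h, g_invariant rG h -> exists p : {mpoly R[m]}, h = subst_inv pi p).

Definition hilbert_map (n m : nat) (pi : 'I_m -> {mpoly R[n]}) (x : 'I_n -> R)
  : 'I_m -> R := fun i => (pi i).@[x].

Definition hilbert_image (n m : nat) (pi : 'I_m -> {mpoly R[n]}) (z : 'I_m -> R)
  : Prop := exists x : 'I_n -> R, z = hilbert_map pi x.

Definition rel_ideal (n m : nat) (pi : 'I_m -> {mpoly R[n]}) (p : {mpoly R[m]})
  : Prop := subst_inv pi p = 0.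

Definition real_zero_set (n m : nat) (pi : 'I_m -> {mpoly R[n]}) (z : 'I_m -> R)
  : Prop := forall p, rel_ideal pi p -> p.@[z] = 0.

(* phi_z(g) > 0, where phi_z(p(pi_1,...,pi_m)) = p(z) (well defined for z in
   V_R(I_Pi)). *)
Definition phi_pos (n m : nat) (pi : 'I_m -> {mpoly R[n]}) (z : 'I_m -> R)
    (g : {mpoly R[n]}) : Prop :=
  exists p : {mpoly R[m]}, g = subst_inv pi p /\ 0 < p.@[z].

(* Dimension of a subset A of R^k: the dimension of its Zariski closure, i.e.
   the largest number of coordinates that are algebraically independent on A.
   [alg_indep_on A s] : the coordinates listed in s are pairwise distinct and
   no nonzero polynomial in them vanishes on A. *)
Definition alg_indep_on (k : nat) (A : ('I_k -> R) -> Prop) (s : seq 'I_k) : Prop :=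
  uniq s /\
  forall p : {mpoly R[size s]},
    (forall y, A y -> p.@[fun j => y (tnth (in_tuple s) j)] = 0) -> p = 0.

(* dim A < dim B  (with dim of the empty set = -infinity). *)
Definition dim_lt (k : nat) (A B : ('I_k -> R) -> Prop) : Prop :=
  forall s, alg_indep_on A s ->
    exists2 s', alg_indep_on B s' & (size s < size s')%N.

Definition generically_described (n m : nat) (pi : 'I_m -> {mpoly R[n]})
    (gs : seq {mpoly R[n]}) : Prop :=
  exists T : ('I_m -> R) -> Prop,
    (forall z, hilbert_image pi z <->
       ((real_zero_set pi z /\ (forall g, g \in gs -> phi_pos pi z g)) \/ T z)) /\
    dim_lt T (hilbert_image pi).

Definition chain_poly (gT : finGroupType) (G : {group gT}) (n : nat)
    (rG : mx_representation R G n) (H : nat -> {group gT}) (l : nat)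
  : {mpoly R[n]} :=
  \prod_(C in lcosets (H l) G)
     mact rG (repr C)
       (reynolds rG (H l)
          (\sum_(i < n) ('X_i - reynolds rG (H 1%N) 'X_i) ^+ 2)).
End Defs.

(* Main.v *)
(* A point z of V_R(I_Pi) lifts to some x in C^n with f(x) = phi_z(f) for every
   invariant f. These values being real, x and its complex conjugate lie in the
   same orbit: conj x = s x. If s has odd order then x is real. Otherwise a power r
   of s has order 2 and either fixes x or maps it to conj x. By hypothesis H_l has
   a unique involution t, and every involution of G is conjugate to t. The factor
   of g at the coset C = a H_l takes at x the value of an average over h in H_l of
   sum_i ((y - t y)_i / 2)^2 at y = h^-1 a^-1 x. If r x = x, the factor at a coset
   with r C = C vanishes. If r x = conj x, the factors at C and r C are conjugate,
   those with r C = C are <= 0, and the number q of cosets is odd, so g(x) <= 0.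
   Hence phi_z(g) > 0 forces z into the image. The remaining points of the image
   lie on g = 0, and a transcendence basis argument bounds their dimension. *)

Require Import Defs.
From HB Require Import structures.
From mathcomp Require Import all_boot all_order all_algebra all_fingroup all_solvable.
From mathcomp Require Import mxrepresentation.
From mathcomp Require Import reals boolp.
From mathcomp Require Import complex.
From mathcomp Require Import ring.
From mathcomp Require Import mpoly.
Import Order.TTheory GRing.Theory Num.Theory.
Local Open Scope ring_scope.
Set Implicit Arguments. Unset Strict Implicit. Unset Printing Implicit Defensive.

(** * Polynomial identities and algebraic elements *)

Lemma poly_eq0_natr (F : numDomainType) (p : {poly F}) :
  (forall k : nat, p.[k%:R] = 0) -> p = 0.
Proof.
move=> p0; apply/eqP/contraT => pn0.
have /= := max_poly_roots (rs := [seq k%:R | k <- iota 0 (size p)]) pn0.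
rewrite size_map size_iota ltnn; apply.
  by apply/allP => _ /mapP[k _ ->]; rewrite rootE p0.
by rewrite map_inj_uniq ?iota_uniq //; apply/mulrIn/oner_neq0.
Qed.

(** Equalities between evaluations, substitutions and group actions are all reduced by this to
    constants and variables. *)
Lemma mpoly_rmorph_eq (n : nat) (R S : comNzRingType)
    (f g : {rmorphism {mpoly R[n]} -> S}) :
  (forall c, f c%:MP = g c%:MP) -> (forall i, f 'X_i = g 'X_i) -> f =1 g.
Proof.
move=> fgC fgX; elim/mpolyind => [|c m p _ _ IH]; first by rewrite !rmorph0.
rewrite !rmorphD /= IH -!mul_mpolyC !rmorphM /= fgC; congr (_ * _ + _).
rewrite mpolyXE_id !rmorph_prod; apply: eq_bigr => i _.
by rewrite !rmorphXn /= fgX.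
Qed.

Section Split.
Variables (n : nat) (R : comNzRingType).

Definition msplit : {mpoly R[n.+1]} -> {poly {mpoly R[n]}} :=
  mmap (polyC \o @mpolyC n R)
    (fun i => if unlift ord0 i is Some j then ('X_j)%:P else 'X).

HB.instance Definition _ := GRing.RMorphism.on msplit.

Definition munsplit : {poly {mpoly R[n]}} -> {mpoly R[n.+1]} :=
  horner_eval 'X_ord0 \o
    map_poly (comp_mpoly [tuple 'X_(lift ord0 i) | i < n]).

HB.instance Definition _ := GRing.RMorphism.on munsplit.

Lemma msplitC c : msplit c%:MP = (c%:MP)%:P.
Proof. by rewrite /msplit mmapC. Qed.

Lemma msplitX i :
  msplit 'X_i = if unlift ord0 i is Some j then ('X_j)%:P else 'X.
Proof. by rewrite /msplit mmapX mmap1U. Qed.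

Lemma msplitK : cancel msplit munsplit.
Proof.
apply: (@mpoly_rmorph_eq _ _ _ (munsplit \o msplit) idfun) => [c|i] /=.
  by rewrite msplitC /munsplit /= map_polyC /= /horner_eval hornerC comp_mpolyC.
rewrite msplitX /munsplit /= /horner_eval; case: unliftP => [j ->|->].
  by rewrite map_polyC hornerC /= comp_mpolyXU -tnth_nth tnth_mktuple.
by rewrite map_polyX hornerX.
Qed.

Lemma horner_msplit (S : comNzRingType) (h : {rmorphism {mpoly R[n]} -> S}) (a : S) p :
  (map_poly h (msplit p)).[a] =
  mmap (h \o @mpolyC n R) (fun i => if unlift ord0 i is Some j then h 'X_j else a) p.
Proof.
pose f : {rmorphism _ -> _} := horner_eval a \o (map_poly h \o msplit).
apply: (@mpoly_rmorph_eq _ _ _ f (mmap (h \o @mpolyC n R) _)) => [c|i].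
  by rewrite /f /= msplitC map_polyC /= /horner_eval hornerC mmapC.
rewrite /f /= msplitX mmapX mmap1U /horner_eval; case: unliftP => [j _|_].
  by rewrite map_polyC hornerC.
by rewrite map_polyX hornerX.
Qed.

End Split.

(** Induction on [n]: with the other variables fixed, the polynomial in ['X_ord0] vanishes at every
    natural number, so each of its coefficients vanishes at every point. *)
Lemma mpoly_eq0_meval (F : numDomainType) (n : nat) (p : {mpoly F[n]}) :
  (forall x : 'I_n -> F, p.@[x] = 0) -> p = 0.
Proof.
elim: n p => [|n IH] p p0.
  have pE : p = (p.@[fun=> 0])%:MP.
    apply: (@mpoly_rmorph_eq _ _ _ idfun (@mpolyC 0 F \o meval (fun=> 0))) => [c|[]//].
    by rewrite /= mevalC.
  by rewrite pE p0 mpolyC0.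
suff: msplit p = 0 by move=> sp0; rewrite -[p]msplitK sp0 rmorph0.
apply/polyP => k; rewrite coef0; apply: IH => x.
suff: map_poly (meval x) (msplit p) = 0 by move/polyP/(_ k); rewrite coef_map coef0.
apply: poly_eq0_natr => j; rewrite (horner_msplit (meval x)).
rewrite -[RHS](p0 (fun i => if unlift ord0 i is Some j then x j else j%:R)).
apply: (@mpoly_rmorph_eq _ _ _ (mmap (meval x \o @mpolyC n F) _) (meval _)) => [c|i].
  by rewrite /= mmapC mevalC /= mevalC.
by rewrite /= mmapX mmap1U mevalXU; case: unliftP => [j' _|//]; rewrite mevalXU.
Qed.

Section Algebraic.
Variables (A B : idomainType) (f : {rmorphism A -> B}).

(* Clearing denominators by [f c] avoids passing to fraction fields. *)
Definition algebraic_elt (b : B) :=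
  exists2 c, f c != 0 & integralOver f (f c * b).

Lemma algebraic_elt_integral b : integralOver f b -> algebraic_elt b.
Proof. by exists 1; rewrite rmorph1 ?oner_eq0 ?mul1r. Qed.

Lemma algebraic_elt_add b b' :
  algebraic_elt b -> algebraic_elt b' -> algebraic_elt (b + b').
Proof.
move=> [c c0 ib] [c' c'0 ib']; exists (c * c'); first by rewrite rmorphM mulf_neq0.
have -> : f (c * c') * (b + b') = f c' * (f c * b) + f c * (f c' * b').
  by rewrite rmorphM; ring.
by apply: integral_add; apply: integral_mul => //; apply: integral_id.
Qed.

Lemma algebraic_elt_mul b b' :
  algebraic_elt b -> algebraic_elt b' -> algebraic_elt (b * b').
Proof.
move=> [c c0 ib] [c' c'0 ib']; exists (c * c'); first by rewrite rmorphM mulf_neq0.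
by rewrite rmorphM mulrACA; apply: integral_mul.
Qed.

Lemma algebraic_elt_root (p : {poly A}) b :
  injective f -> p != 0 -> root (map_poly f p) b -> algebraic_elt b.
Proof.
move=> f_inj p0 pb0.
have lp0 : f (lead_coef p) != 0.
  by rewrite -(rmorph0 f) (inj_eq f_inj) lead_coef_eq0.
have szfp : size (map_poly f p) = size p by rewrite size_map_poly_id0.
(* As [f] is injective, a nonzero constant keeps no root, so the degree [d.+1] is positive. *)
have [d sz_p] : exists d, size p = d.+2.
  case sz: (size p) => [|[|d]]; last by exists d.
    by move/eqP: sz; rewrite size_poly_eq0 (negbTE p0).
  move: pb0; rewrite (size1_polyC (_ : size (map_poly f p) <= 1)%N) ?szfp ?sz //.
  rewrite rootC coef_map => /eqP c0.
  by move: lp0; rewrite lead_coefE sz c0 eqxx.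
have lpE : lead_coef p = p`_d.+1 by rewrite lead_coefE sz_p.
exists (lead_coef p) => //.
(* With [a] the leading coefficient of [p], multiplying the equation for [b] by [f a ^+ d] gives a
   monic equation for [f a * b], whose lower part is [r]. *)
pose r := \poly_(i < d.+1) (p`_i * p`_d.+1 ^+ (d - i)).
have szr : (size r <= d.+1)%N by apply: size_poly.
exists ('X^(d.+1) + r).
  by rewrite monicE lead_coefDl ?lead_coefXn // size_polyXn ltnS.
move: pb0; rewrite !rootE rmorphD /= map_polyXn hornerD hornerXn.
rewrite horner_coef szfp sz_p big_ord_recr /= coef_map.
move=> /eqP pb0.
rewrite (@horner_coef_wide _ d.+1); last by rewrite (leq_trans (size_poly _ _)).
apply/eqP; move/(congr1 ( *%R (f p`_d.+1 ^+ d))): pb0; rewrite mulr0 => pb; apply: etrans pb.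
rewrite lpE mulrDr addrC big_distrr /=.
congr (_ + _); last by rewrite exprMn exprSr -!mulrA.
apply: eq_bigr => i _.
rewrite !coef_map coef_poly ltn_ord /= rmorphM rmorphXn exprMn mulrACA.
have -> : f p`_d.+1 ^+ d = f p`_d.+1 ^+ (d - i) * f p`_d.+1 ^+ i.
  by rewrite -exprD subnK // -ltnS.
ring.
Qed.

(** In an equation for [b] with nonzero constant term, the image of that term is a multiple of [b].
    Since [b] is nonzero, factors ['X] can be cancelled until such an equation is reached. *)
Lemma algebraic_elt_divides b :
  injective f -> b != 0 -> algebraic_elt b ->
  exists2 c, c != 0 & exists h, f c = h * b.
Proof.
move=> f_inj b0 [c c0 [q qm qb]].
have {q qm qb} [p p0] : exists2 p, p != 0 & root (map_poly f p) b.
  (* Turns the monic equation for [f c * b] into a nonzero equation for [b]. *)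
  exists (q \Po (c *: 'X)).
    rewrite -size_poly_eq0 size_comp_poly2 ?size_poly_eq0 ?monic_neq0 //.
    rewrite size_scale ?size_polyX //.
    by rewrite -(inj_eq f_inj) rmorph0.
  rewrite map_comp_poly linearZ /= map_polyX.
  by rewrite rootE horner_comp hornerZ hornerX.
elim/poly_ind: p p0 => [|p a IH]; first by rewrite eqxx.
rewrite rootE rmorphD rmorphM /= map_polyX map_polyC /= hornerMXaddC.
have [->|a0 _ pb] := eqVneq a 0.
  rewrite polyC0 rmorph0 !addr0 => pX; rewrite mulf_eq0 (negbTE b0) orbF; apply: IH.
  by apply: contraNneq pX => ->; rewrite mul0r.
exists a => //; exists (- (map_poly f p).[b]).
by rewrite mulNr; apply/eqP; rewrite -addr_eq0 addrC.
Qed.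

End Algebraic.

(** * Dimension of a zero set in the image *)

Section Dimension.
Variables (R : realType) (n m : nat) (pi : 'I_m -> {mpoly R[n]}).

Definition subst_seq (s : seq 'I_m) : {mpoly R[size s]} -> {mpoly R[n]} :=
  comp_mpoly [tuple pi (tnth (in_tuple s) i) | i < size s].

Arguments subst_seq : clear implicits.

HB.instance Definition _ s := GRing.RMorphism.on (subst_seq s).

Lemma meval_subst_seq s p x :
  (subst_seq s p).@[x] = p.@[fun i => hilbert_map pi x (tnth (in_tuple s) i)].
Proof.
rewrite /subst_seq comp_mpoly_meval; apply: meval_eq => i.
by rewrite tnth_mktuple.
Qed.

Lemma subst_seqC s c : subst_seq s c%:MP = c%:MP.
Proof. exact: comp_mpolyC. Qed.

Lemma subst_seqX s i : subst_seq s 'X_i = pi (tnth (in_tuple s) i).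
Proof. by rewrite /subst_seq comp_mpolyXU -tnth_nth tnth_mktuple. Qed.

Lemma algebraic_subst_inv s :
  (forall j, algebraic_elt (subst_seq s) (pi j)) ->
  forall p, algebraic_elt (subst_seq s) (subst_inv pi p).
Proof.
move=> algpi p.
have algC (c : R) : algebraic_elt (subst_seq s) c%:MP.
  by apply: algebraic_elt_integral; rewrite -(subst_seqC s); apply: integral_id.
rewrite /subst_inv; elim/mpolyind: p => [|c mon p _ _ IH].
  by rewrite comp_mpoly0 -mpolyC0.
rewrite comp_mpolyD comp_mpolyZ -mul_mpolyC; apply: algebraic_elt_add => //.
apply: algebraic_elt_mul => //; rewrite comp_mpolyX.
elim/big_ind: _ => [|x y|i _]; first by rewrite -mpolyC1.
  exact: algebraic_elt_mul.
rewrite tnth_mktuple; elim: (mon i) => [|k IHk]; first by rewrite expr0 -mpolyC1.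
by rewrite exprS; apply: algebraic_elt_mul.
Qed.

(** For [j] outside [s], a relation between [pi j] and the invariants listed in [s] is read through
    [msplit] as a polynomial equation for [pi j], with coefficients in the latter. *)
Lemma algebraic_dependent s j :
  injective (subst_seq s) -> uniq s ->
  ~ alg_indep_on (hilbert_image pi) (j :: s) -> algebraic_elt (subst_seq s) (pi j).
Proof.
move=> inj_s us dep; have [js|js] := boolP (j \in s).
  have js' : (index j s < size s)%N by rewrite index_mem.
  apply: algebraic_elt_integral.
  have -> : pi j = subst_seq s 'X_(Ordinal js').
    by rewrite subst_seqX (tnth_nth j) /= nth_index.
  exact: integral_id.
have [p [p0 pn0]] : exists p : {mpoly R[(size s).+1]},
    (forall x, p.@[fun i => hilbert_map pi x (tnth (in_tuple (j :: s)) i)] = 0) /\ p != 0.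
  apply: contrapT => nex; apply: dep; split; first by rewrite /= js.
  move=> p p0; apply/eqP/contraT => pn0; case: nex; exists p; split => // x.
  by apply: p0; exists x.
apply: (@algebraic_elt_root _ _ _ (msplit p)) => //.
  by apply: contraNneq pn0 => sp0; rewrite -[p]msplitK sp0 rmorph0.
rewrite rootE (horner_msplit (subst_seq s)); apply/eqP/mpoly_eq0_meval => x.
rewrite -[RHS](p0 x).
apply: (@mpoly_rmorph_eq _ _ _
  (meval x \o mmap (subst_seq s \o @mpolyC (size s) R) _) (meval _)) => [c|i].
  by rewrite /= mmapC /= subst_seqC !mevalC.
rewrite /= mmapX mmap1U mevalXU; case: unliftP => [k ->|->].
  by rewrite subst_seqX /hilbert_map !(tnth_nth j).
by rewrite /hilbert_map (tnth_nth j).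
Qed.

(** If no coordinate extends [s] to a longer independent list on the image, every invariant is
    algebraic over those in [s]. Some nonzero polynomial in them is then a multiple of
    [subst_inv pi p], so it vanishes on [T], against the independence of [s] on [T]. *)
Lemma dim_lt_vanishing (T : ('I_m -> R) -> Prop) (p : {mpoly R[m]}) :
  subst_inv pi p != 0 -> (forall z, T z -> hilbert_image pi z) ->
  (forall z, T z -> p.@[z] = 0) -> dim_lt T (hilbert_image pi).
Proof.
move=> p0 sTI Tp s [us inds].
have [[j indj]|nind] := pselect (exists j, alg_indep_on (hilbert_image pi) (j :: s)).
  by exists (j :: s).
have inj_s : injective (subst_seq s).
  apply: raddf_inj => q q0; apply: inds => z /sTI[x ->].
  by rewrite -meval_subst_seq q0 meval0.
have [c c0 [h ch]] : exists2 c, c != 0 & exists h, subst_seq s c = h * subst_inv pi p.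
  apply: algebraic_elt_divides => //; apply: algebraic_subst_inv => j.
  by apply: algebraic_dependent => // indj; apply: nind; exists j.
case/eqP: c0; apply: inds => z Tz; have [x zx] := sTI z Tz.
rewrite zx -meval_subst_seq ch mevalM.
have -> : (subst_inv pi p).@[x] = p.@[z].
  by rewrite zx comp_mpoly_meval; apply: meval_eq => i; rewrite tnth_mktuple.
by rewrite Tp // mulr0.
Qed.

End Dimension.

(** * Complex points and invariants *)

Section Invariants.
Variables (R : realType) (gT : finGroupType) (G : {group gT}) (n : nat).
Variable rG : mx_representation R G n.
Local Notation C := (complex R).
Local Notation toC := (real_complex R).
Local Notation conj := (@conjc R).
Implicit Types (x y : 'cV[C]_n) (h f : {mpoly R[n]}) (s t : gT) (K : {set gT}).

Definition evalC x : {mpoly R[n]} -> C := mmap toC (fun i => x i 0).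

HB.instance Definition _ x := GRing.RMorphism.on (evalC x).

Lemma evalCC x c : evalC x c%:MP = toC c.
Proof. by rewrite /evalC mmapC. Qed.

Lemma evalCX x i : evalC x 'X_i = x i 0.
Proof. by rewrite /evalC mmapX mmap1U. Qed.

Lemma evalCZ x c h : evalC x (c *: h) = toC c * evalC x h.
Proof. by rewrite -mul_mpolyC rmorphM /= evalCC. Qed.

Lemma evalC_conj x h : evalC (map_mx conj x) h = conj (evalC x h).
Proof.
apply: (@mpoly_rmorph_eq _ _ _ (evalC _) (conj \o evalC x)) => [c|i] /=.
  by rewrite !evalCC conjc_real.
by rewrite !evalCX mxE.
Qed.

Lemma evalC_real (v : 'I_n -> R) h : evalC (\col_i toC (v i)) h = toC h.@[v].
Proof.
apply: (@mpoly_rmorph_eq _ _ _ (evalC _) (toC \o meval v)) => [c|i] /=.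
  by rewrite evalCC mevalC.
by rewrite evalCX mevalXU mxE.
Qed.

(** Real points already suffice. The composition laws of [mact] are deduced through this from those
    of [actC] on points. *)
Lemma evalC_inj h f : (forall x, evalC x h = evalC x f) -> h = f.
Proof.
move=> hf; apply/eqP; rewrite -subr_eq0; apply/eqP/mpoly_eq0_meval => v.
by apply: (@complexI R); rewrite -evalC_real rmorphB /= hf subrr.
Qed.

Definition actC s x : 'cV[C]_n := map_mx toC (rG s) *m x.

Lemma actC1 x : actC 1%g x = x.
Proof. by rewrite /actC repr_mx1 map_mx1 mul1mx. Qed.

Lemma actCM s t x : s \in G -> t \in G -> actC (s * t)%g x = actC s (actC t x).
Proof. by move=> sG tG; rewrite /actC repr_mxM // map_mxM mulmxA. Qed.

Lemma actC_conj s x : actC s (map_mx conj x) = map_mx conj (actC s x).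
Proof.
rewrite /actC map_mxM; congr (_ *m _).
by apply/matrixP => i j; rewrite !mxE /= oppr0.
Qed.

Local Notation mact := (@Defs.mact R gT G n rG).
Local Notation reynolds := (@reynolds R gT G n rG).
Local Notation g_invariant := (@g_invariant R gT G n rG).

HB.instance Definition _ s := GRing.RMorphism.copy (mact s)
  (comp_mpoly [tuple (\sum_(j < n) (invmx (rG s)) i j *: 'X_j) | i < n]).

Lemma evalC_mact s x h : s \in G -> evalC x (mact s h) = evalC (actC s^-1%g x) h.
Proof.
move=> sG; apply: (@mpoly_rmorph_eq _ _ _ (evalC x \o mact s) (evalC _)) => [c|i] /=.
  by rewrite /Defs.mact comp_mpolyC !evalCC.
rewrite /Defs.mact comp_mpolyXU -tnth_nth tnth_mktuple evalCX raddf_sum mxE.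
apply: eq_bigr => j _.
by rewrite /= evalCZ evalCX mxE repr_mxV.
Qed.

Lemma mactM s t h : s \in G -> t \in G -> mact (s * t)%g h = mact s (mact t h).
Proof.
move=> sG tG; apply: evalC_inj => x.
by rewrite !evalC_mact ?groupM // invMg actCM ?groupV.
Qed.

Lemma mact1 h : mact 1%g h = h.
Proof. by apply: evalC_inj => x; rewrite evalC_mact ?group1 // invg1 actC1. Qed.

Lemma mactC s c : mact s c%:MP = c%:MP.
Proof. by rewrite /Defs.mact comp_mpolyC. Qed.

Lemma mactZ s c h : mact s (c *: h) = c *: mact s h.
Proof. by rewrite -!mul_mpolyC rmorphM /= mactC. Qed.

Lemma mact_reynolds (K : {group gT}) s h :
  K \subset G -> s \in K -> mact s (reynolds K h) = reynolds K h.
Proof.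
move=> sKG sK; rewrite /Defs.reynolds mactZ rmorph_sum; congr (_ *: _).
rewrite [RHS](reindex_inj (mulgI s)) /=.
apply: eq_big => [t|t tK]; first by rewrite groupMl.
by rewrite -mactM // (subsetP sKG).
Qed.

Lemma evalC_reynolds K x h : K \subset G ->
  evalC x (reynolds K h) = toC (#|K|%:R)^-1 * \sum_(s in K) evalC (actC s^-1%g x) h.
Proof.
move=> sKG; rewrite /Defs.reynolds evalCZ rmorph_sum; congr (_ * _).
by apply: eq_bigr => s sK; rewrite /= evalC_mact // (subsetP sKG).
Qed.

Lemma reynolds_invariant h : g_invariant (reynolds G h).
Proof. by move=> s sG; apply: mact_reynolds. Qed.

Lemma reynoldsD h f : reynolds G (h + f) = reynolds G h + reynolds G f.
Proof.
rewrite /Defs.reynolds -scalerDr -big_split; congr (_ *: _).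
by apply: eq_bigr => s _; rewrite /= rmorphD.
Qed.

Lemma reynoldsM f h : g_invariant f -> reynolds G (f * h) = f * reynolds G h.
Proof.
move=> invf; rewrite /Defs.reynolds -scalerAr big_distrr; congr (_ *: _).
by apply: eq_bigr => s sG; rewrite /= rmorphM /= invf.
Qed.

Lemma reynolds1 : reynolds G 1 = 1.
Proof.
rewrite /Defs.reynolds (eq_bigr (fun=> 1)) => [|s _]; last by rewrite rmorph1.
rewrite sumr_const -scaler_nat scalerA mulVf ?scale1r //.
by rewrite pnatr_eq0 -lt0n cardG_gt0.
Qed.

Lemma g_invariantC c : g_invariant c%:MP.
Proof. by move=> s _; rewrite mactC. Qed.

(** Serves twice: as an integral equation for [h] over the invariants, and, evaluated at a point, as
    the polynomial whose roots are the values of [h] on its orbit. *)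
Definition orbit_poly h : {poly {mpoly R[n]}} :=
  \prod_(s in G) ('X - (mact s h)%:P).

Lemma orbit_poly_invariant h k : g_invariant (orbit_poly h)`_k.
Proof.
move=> s sG.
suff /(congr1 (fun q : {poly _} => q`_k)) :
    map_poly (mact s) (orbit_poly h) = orbit_poly h.
  by rewrite coef_map.
rewrite /orbit_poly rmorph_prod [RHS](reindex_inj (mulgI s)) /=.
apply: eq_big => [t|t tG]; first by rewrite groupMl.
by rewrite rmorphB /= map_polyX map_polyC /= mactM.
Qed.

Lemma orbit_poly_monic h : orbit_poly h \is monic.
Proof. by apply: monic_prod => s _; apply: monicXsubC. Qed.

Lemma orbit_poly_root h : (orbit_poly h).[h] = 0.
Proof.
rewrite /orbit_poly horner_prod (bigD1 1%g (group1 G)).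
apply/eqP; rewrite mulf_eq0 mact1; apply/orP; left.
by rewrite hornerXsubC subrr.
Qed.

(* A homomorphism [phi : R[X]^G -> R] lifts to a point of C^n: the functional
   [phi \o reynolds G] is [R[X]^G]-linear, and since each ['X_i] is integral over
   the invariants, it can be modified, one variable at a time, into a common
   eigenvector of the multiplications by the ['X_i]. The eigenvalues are the
   coordinates of the point. *)
Section Lift.
Variable phi : {mpoly R[n]} -> R.
Hypothesis phiC : forall c, phi c%:MP = c.

(** Values lie in C because the eigenvalues sought are roots of real polynomials that need not split
    over R. *)
Definition phi_linear (psi : {mpoly R[n]} -> C) :=
  [/\ forall h f, psi (h + f) = psi h + psi f,
      forall a h, g_invariant a -> psi (a * h) = toC (phi a) * psi h &
      exists h, psi h != 0].

Definition eigen_functional (psi : {mpoly R[n]} -> C) i (r : C) :=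
  forall h, psi ('X_i * h) = r * psi h.

Definition shift i (r : C) (psi : {mpoly R[n]} -> C) h := psi ('X_i * h) - r * psi h.

Lemma phi_linear0 psi : phi_linear psi -> psi 0 = 0.
Proof. by case=> D _ _; apply: (addrI (psi 0)); rewrite -D !addr0. Qed.

Lemma phi_linear_sum psi : phi_linear psi ->
  forall (I : finType) (F : I -> {mpoly R[n]}), psi (\sum_i F i) = \sum_i psi (F i).
Proof.
move=> psiL I F; apply: (big_morph psi); last exact: phi_linear0.
by case: psiL.
Qed.

(** Only the nonvanishing clause can fail for the shift, and the shift is zero exactly when [psi] is
    already an eigenvector for [r]. *)
Lemma phi_linear_shift i r psi : phi_linear psi ->
  eigen_functional psi i r \/ phi_linear (shift i r psi).
Proof.
move=> [D L [h0 nz]]; have [e|ne] := pselect (eigen_functional psi i r); [by left|right].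
split=> [h f|a h inva|].
- by rewrite /shift mulrDr !D mulrDr; ring.
- by rewrite /shift mulrCA !(L a) //; ring.
apply: contrapT => nex; apply: ne => h; apply/eqP; rewrite -subr_eq0.
by apply: contrapT => /negP ne; apply: nex; exists h.
Qed.

Lemma eigen_shift i r j (t : C) psi :
  eigen_functional psi j t -> eigen_functional (shift i r psi) j t.
Proof. by move=> e h; rewrite /shift mulrCA !e; ring. Qed.

(** The polynomial [q] in the operator dual to multiplication by ['X_i], applied to [psi]. *)
Definition poly_functional i (q : {poly C}) (psi : {mpoly R[n]} -> C) h :=
  \sum_(k < size q) q`_k * psi ('X_i ^+ k * h).

Lemma poly_functional_wide i (q : {poly C}) psi h N : (size q <= N)%N ->
  poly_functional i q psi h = \sum_(k < N) q`_k * psi ('X_i ^+ k * h).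
Proof.
move=> leN; rewrite /poly_functional.
rewrite (big_ord_widen N (fun k => q`_k * psi ('X_i ^+ k * h))) //.
rewrite big_mkcond; apply: eq_bigr => k _; case: ltnP => // le.
by rewrite nth_default // mul0r.
Qed.

Lemma poly_functional_shift i r (q : {poly C}) psi h :
  poly_functional i (('X - r%:P) * q) psi h = poly_functional i q (shift i r psi) h.
Proof.
rewrite (@poly_functional_wide _ _ _ _ (size q).+1); last first.
  by rewrite (leq_trans (size_polyMleq _ _)) // size_XsubC.
rewrite /poly_functional.
under eq_bigr do rewrite mulrBl coefB coefXM coefCM mulrBl.
rewrite big_split /= sumrN big_ord_recl mul0r add0r.
rewrite [X in _ - X]big_ord_recr /= [q`_(size q)]nth_default // mulr0 mul0r addr0.
rewrite -sumrB; apply: eq_bigr => k _.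
by rewrite /= /shift mulrA -exprS; ring.
Qed.

(** The factors are applied one after the other to the nonzero [psi]; the last functional before the
    result becomes zero is an eigenvector. Eigenvectors for other variables survive because
    multiplications commute. *)
Lemma eigen_step i (rs : seq C) psi : phi_linear psi ->
  (forall h, poly_functional i (\prod_(r <- rs) ('X - r%:P)) psi h = 0) ->
  exists r psi', [/\ phi_linear psi', eigen_functional psi' i r &
    forall j (t : C), eigen_functional psi j t -> eigen_functional psi' j t].
Proof.
elim: rs psi => [|r rs IH] psi psiL psi0.
  have [_ _ [h]] := psiL; case/eqP.
  have := psi0 h; rewrite big_nil /poly_functional size_poly1 big_ord1.
  by rewrite coef1 !mul1r.
have [e|sL] := phi_linear_shift i r psiL; first by exists r, psi.
have [h|r' [psi' [psi'L e pres]]] := IH _ sL.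
  by move: (psi0 h); rewrite big_cons poly_functional_shift.
by exists r', psi'; split=> // j t /(@eigen_shift i r)/pres.
Qed.

Lemma eigen_extend i psi : phi_linear psi ->
  exists r psi', [/\ phi_linear psi', eigen_functional psi' i r &
    forall j (t : C), eigen_functional psi j t -> eigen_functional psi' j t].
Proof.
move=> psiL; have [D L _] := psiL.
pose P := orbit_poly 'X_i; pose Q := \poly_(k < size P) toC (phi P`_k).
have Qn0 : lead_coef Q = 1.
  have szP : (0 < size P)%N by rewrite size_poly_gt0 monic_neq0 ?orbit_poly_monic.
  have cP : toC (phi P`_(size P).-1) = 1.
    move/monicP: (orbit_poly_monic 'X_i); rewrite lead_coefE -/P => ->.
    by rewrite -mpolyC1 phiC.
  by rewrite lead_coef_poly // cP oner_eq0.
have [rs Qrs] := closed_field_poly_normal Q.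
rewrite Qn0 scale1r in Qrs.
apply: (@eigen_step i rs) => // h; rewrite -Qrs.
rewrite (@poly_functional_wide _ _ _ _ (size P)) ?size_poly //.
transitivity (psi (P.[ 'X_i ] * h)); last by rewrite orbit_poly_root mul0r phi_linear0.
rewrite horner_coef big_distrl phi_linear_sum //; apply: eq_bigr => k _.
rewrite /= -mulrA (L P`_k); last exact: orbit_poly_invariant.
by rewrite coef_poly ltn_ord.
Qed.

Lemma eigen_all psi : phi_linear psi ->
  exists (x : 'cV[C]_n) psi', phi_linear psi' /\
    forall i, eigen_functional psi' i (x i 0).
Proof.
move=> psiL.
suff [psi' [psi'L e]] : exists psi', phi_linear psi' /\
    forall i, i \in enum 'I_n -> exists r, eigen_functional psi' i r.
  have /boolp.choice[x xP] : forall i, exists r, eigen_functional psi' i r.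
    by move=> i; apply: e; rewrite mem_enum.
  exists (\col_i x i), psi'; split=> // i.
  by rewrite mxE.
elim: (enum _) => [|i l [psi' [psi'L e]]]; first by exists psi.
have [r [psi2 [psi2L er pres]]] := eigen_extend i psi'L.
exists psi2; split=> // j; rewrite inE => /predU1P[->|/e[t ej]]; first by exists r.
by exists t; apply: pres.
Qed.

Hypothesis phiD : forall f h, g_invariant f -> g_invariant h -> phi (f + h) = phi f + phi h.
Hypothesis phiM : forall f h, g_invariant f -> g_invariant h -> phi (f * h) = phi f * phi h.

Lemma lift_point : exists x, forall f, g_invariant f -> evalC x f = toC (phi f).
Proof.
have psiL : phi_linear (fun h => toC (phi (reynolds G h))).
  split=> [h f|a h inva|].
  - rewrite reynoldsD phiD ?rmorphD //; exact: reynolds_invariant.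
  - rewrite reynoldsM // phiM ?rmorphM //; exact: reynolds_invariant.
  by exists 1; rewrite reynolds1 -mpolyC1 phiC oner_eq0.
have [x [psi [psiL' e]]] := eigen_all psiL.
have [D L [h0 nz]] := psiL'.
(* The eigenvalues extend multiplicatively, so [psi] is evaluation at [x] up to the factor [psi 1];
   comparison with linearity over the invariants then gives the claim. *)
have psiE f h : psi (f * h) = evalC x f * psi h.
  elim/mpolyind: f h => [|c mon f _ _ IH] h.
    by rewrite mul0r rmorph0 mul0r (phi_linear0 psiL').
  rewrite mulrDl D IH rmorphD mulrDl /= evalCZ -mul_mpolyC -mulrA.
  rewrite L ?phiC; last exact: g_invariantC.
  rewrite -mulrA; congr (_ * _ + _).
  rewrite mpolyXE_id rmorph_prod; elim: (index_enum _) h => [|i l IHl] h.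
    by rewrite !big_nil !mul1r.
  rewrite !big_cons -!mulrA -IHl; move: (\prod_(j <- l) _ * h) => h'.
  rewrite rmorphXn /= evalCX; elim: (mon i) => [|k IHk]; first by rewrite !mul1r.
  by rewrite !exprS -!mulrA e IHk.
have psi1 : psi 1 != 0.
  by apply: contraNneq nz => psi1; rewrite -[h0]mulr1 psiE psi1 mulr0.
exists x => f invf; apply: (mulIf psi1).
by rewrite -psiE L.
Qed.

End Lift.
End Invariants.

(** * Orbits, involutions and signs *)

Section Orbits.
Variables (R : realType) (gT : finGroupType) (G : {group gT}) (n : nat).
Variable rG : mx_representation R G n.
Local Notation C := (complex R).
Local Notation actC := (@actC R gT G n rG).
Implicit Types x y : 'cV[C]_n.

(** A linear form whose value at [y] differs from all its values on the orbit of [x] would have an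
    orbit polynomial with a root at [y] that is no root at [x], although its invariant coefficients
    agree at both points. *)
Lemma orbit_separation x y :
  (forall f, g_invariant rG f -> evalC x f = evalC y f) ->
  exists2 s, s \in G & y = actC s x.
Proof.
move=> xy; apply: contrapT => nex.
pose v s := y - actC s x.
have v0 s : s \in G -> v s != 0.
  by rewrite subr_eq0 => sG; apply/eqP => yE; apply: nex; exists s.
(* The value of [p s] at [k] is that of the linear form with coefficients [k ^+ i] at
   [y - actC s x]. A natural number [k] keeps the form real. *)
pose p s : {poly C} := \sum_(i < n) v s i 0 *: 'X^i.
have p0 s : s \in G -> p s != 0.
  move=> /v0; apply: contraNneq => ps0; apply/eqP/colP => i; rewrite [RHS]mxE.
  move/polyP/(_ i): ps0; rewrite coef0 coef_sum (bigD1 i) //= coefZ coefXn eqxx mulr1.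
  rewrite big1 ?addr0 // => j ji; rewrite coefZ coefXn.
  by rewrite val_eqE eq_sym (negbTE ji) mulr0.
have [k pk] : exists k : nat, (\prod_(s in G) p s).[k%:R] != 0.
  apply: contrapT => nk; have /eqP : \prod_(s in G) p s = 0.
    apply: poly_eq0_natr => k; apply: contrapT => /eqP pk.
    by apply: nk; exists k.
  by rewrite prodf_seq_eq0 => /hasP[s _ /andP[/p0/negbTE ->]].
(* [L] is a real linear form separating [y] from the orbit of [x]. *)
pose L : {mpoly R[n]} := \sum_(i < n) (k%:R ^+ i) *: 'X_i.
have evL z : evalC z L = \sum_(i < n) k%:R ^+ i * z i 0.
  rewrite rmorph_sum; apply: eq_bigr => i _ /=.
  by rewrite evalCZ evalCX rmorphXn /= rmorph_nat.
have : root (map_poly (evalC x) (orbit_poly rG L)) (evalC y L).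
  have -> : map_poly (evalC x) (orbit_poly rG L) = map_poly (evalC y) (orbit_poly rG L).
    by apply/polyP => i; rewrite !coef_map /= xy //; apply: orbit_poly_invariant.
  by rewrite rootE horner_map orbit_poly_root rmorph0.
rewrite rmorph_prod rootE horner_prod prodf_seq_eq0 => /hasP[s _ /andP[sG]].
rewrite rmorphB /= map_polyX map_polyC hornerXsubC /= evalC_mact // subr_eq0 => /eqP yL.
case/eqP: pk; rewrite horner_prod (bigD1 s^-1%g) ?groupV //=.
apply/eqP; rewrite mulf_eq0; apply/orP; left.
rewrite horner_sum; apply/eqP.
transitivity (evalC y L - evalC (actC s^-1%g x) L); last by rewrite yL subrr.
rewrite !evL -sumrB; apply: eq_bigr => i _.
by rewrite hornerZ hornerXn !mxE; ring.
Qed.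

End Orbits.

Section Involutions.
Variables (gT : finGroupType) (G : {group gT}).
Hypothesis maxE2 : forall E : {group gT}, E \in ('E*_2(G))%g -> #|E| = 2%N.

(** Both involutions lie in the elementary abelian group they generate, hence in a maximal one,
    which has order 2. *)
Lemma commuting_involutions_eq u v : u \in G -> v \in G ->
  #[u]%g = 2%N -> #[v]%g = 2%N -> commute u v -> u = v.
Proof.
move=> uG vG ou ov cuv.
have cUV : (<[v]> \subset 'C(<[u]>))%g.
  rewrite cycle_subG; apply/centP => _ /cycleP[k ->].
  exact/commuteX/commute_sym.
have EuvG : (<[u]> <*> <[v]>)%G \in ('E_2(G))%g.
  apply/pElemP; split; first by rewrite join_subG !cycle_subG uG.
  by rewrite (cprod_abelem _ (cprodEY cUV)) !cycle_abelem ?orbT // ou ov.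
have [E maxE sE] := pmaxElem_exists EuvG.
have cE := maxE2 maxE.
move: sE; rewrite /= join_subG => /andP[sUE sVE].
have EU : <[u]>%g = E by apply/eqP; rewrite eqEcard sUE cE -orderE ou.
have: v \in <[u]>%g by rewrite EU (subsetP sVE) ?cycle_id.
rewrite (cycle2g ou) !inE => /orP[/eqP v1|/eqP //].
by move: ov; rewrite v1 order1.
Qed.

Variable (P : {group gT}).
Hypotheses (sylP : 2.-Sylow(G)%g P).

(** The centre of the nontrivial 2-group [P] contains an involution, which commutes with all others
    and so equals each of them. *)
Lemma Sylow_involution_unique u v : u \in P -> v \in P ->
  #[u]%g = 2%N -> #[v]%g = 2%N -> u = v.
Proof.
have sPG := subsetP (pHall_sub sylP); have pP := pHall_pgroup sylP.
move=> uP vP ou ov.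
have ntZ : ('Z(P) != 1)%g.
  apply/eqP => /(trivg_center_pgroup pP) P1; move: uP; rewrite P1 inE => /eqP u1.
  by move: ou; rewrite u1 order1.
have [_ dvZ _] := pgroup_pdiv (pgroupS (center_sub P) pP) ntZ.
have [z zZ oz] := Cauchy (isT : prime 2) dvZ.
have [zP czP] := centerP _ _ zZ.
have eqz w : w \in P -> #[w]%g = 2%N -> w = z.
  move=> wP ow; apply: commuting_involutions_eq; rewrite ?sPG //.
  exact/commute_sym/czP.
by rewrite (eqz u) // (eqz v).
Qed.

Lemma involution_conj_Sylow u : u \in G -> #[u]%g = 2%N ->
  exists2 s, s \in G & (u ^ s)%g \in P.
Proof.
move=> uG ou.
have pu : (2.-group <[u]>)%g by rewrite /pgroup -orderE ou pnat_id.
have [|s sG sus] := Sylow_Jsub sylP _ pu; first by rewrite cycle_subG.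
by exists s => //; rewrite -cycle_subG cycleJ.
Qed.

End Involutions.

(* Non-fixed pairs contribute [w c * conjc (w c) >= 0], so only the fixed points
   matter for the sign, and their number has the parity of [#|A|]. *)
Lemma paired_prod_sign (R : realType) (T : finType) (A : {set T}) (i : T -> T)
    (w : T -> complex R) :
  {in A, forall c, i c \in A} -> {in A, forall c, i (i c) = c} ->
  {in A, forall c, w (i c) = conjc (w c)} ->
  {in A, forall c, i c = c -> w c <= 0} ->
  0 <= (-1) ^+ #|A| * \prod_(c in A) w c.
Proof.
have [k] := ubnP #|A|; elim: k A => // k IH A; rewrite ltnS => leA iA iK iw fixw.
have [->|[a aA]] := set_0Vmem A; first by rewrite cards0 big_set0 mulr1.
have [ia|ia] := eqVneq (i a) a.
  rewrite (cardsD1 a) aA (big_setD1 a) //= exprS mulrACA mulN1r.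
  apply: mulr_ge0; first by rewrite oppr_ge0 fixw.
  have sA : {subset A :\ a <= A} by move=> c /setD1P[].
  apply: IH; last 3 first.
  - by move=> c /sA; apply: iK.
  - by move=> c /sA; apply: iw.
  - by move=> c /sA; apply: fixw.
  - by rewrite (leq_trans _ leA) // [X in (_ < X)%N](cardsD1 a) aA.
  move=> c /setD1P[ca cA]; rewrite !inE iA // andbT.
  by apply: contraNneq ca => ica; rewrite -(iK c) // ica ia.
have iaA : i a \in A :\ a by rewrite !inE ia iA.
rewrite (cardsD1 a) aA (cardsD1 (i a)) iaA (big_setD1 a) //= (big_setD1 (i a)) //=.
rewrite !exprS !mulN1r opprK mulrA mulrCA; apply: mulr_ge0.
  by rewrite iw // mulcJ_ge0.
have sA : {subset A :\ a :\ i a <= A} by move=> c /setD1P[_ /setD1P[]].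
apply: IH; last 3 first.
- by move=> c /sA; apply: iK.
- by move=> c /sA; apply: iw.
- by move=> c /sA; apply: fixw.
- rewrite (leq_trans _ leA) // [X in (_ < X)%N](cardsD1 a) aA.
  by rewrite [X in (_ < _ + X)%N](cardsD1 (i a)) iaA ltnS leqW.
move=> c /setD1P[cia /setD1P[ca cA]]; rewrite !inE iA // andbT.
apply/andP; split.
  by apply: contraNneq ca => /(congr1 i); rewrite !iK // => ->.
by apply: contraNneq cia => ica; rewrite -ica iK.
Qed.

(** * The product over the cosets *)

Section ChainPoly.
Variables (R : realType) (gT : finGroupType) (G : {group gT}) (n : nat).
Variable rG : mx_representation R G n.
Local Notation C := (complex R).
Local Notation toC := (real_complex R).
Local Notation conj := (@conjc R).
Local Notation actC := (@actC R gT G n rG).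
Local Notation mact := (@Defs.mact R gT G n rG).
Implicit Types x y : 'cV[C]_n.

Hypothesis faithG : mx_faithful rG.
Hypothesis maxE2 : forall E : {group gT}, E \in ('E*_2(G))%g -> #|E| = 2%N.
Variables (H : nat -> {group gT}) (l : nat).
Local Notation P := (H l).
Local Notation T := (H 1).
Hypotheses (sylP : 2.-Sylow(G)%g P) (oT : #|T| = 2%N) (sTP : T \subset P).

Let sPG : P \subset G := pHall_sub sylP.
Let sTG : T \subset G := subset_trans sTP sPG.

Lemma exists_involution : exists2 u, u \in P & #[u]%g = 2%N.
Proof.
have dvT : (2 %| #|T|)%N by rewrite oT.
have [u Tu ou] := Cauchy (isT : prime 2) dvT.
by exists u => //; apply: (subsetP sTP).
Qed.

Lemma chain_bottomE u : u \in P -> #[u]%g = 2%N -> T = [set 1%g; u] :> {set gT}.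
Proof.
move=> uP ou; have dvT : (2 %| #|T|)%N by rewrite oT.
have [t Tt ot] := Cauchy (isT : prime 2) dvT.
have -> : u = t.
  by apply: (Sylow_involution_unique maxE2 sylP) => //; apply: (subsetP sTP).
rewrite -(cycle2g ot); apply/esym/eqP.
by rewrite eqEcard cycle_subG Tt -orderE ot oT.
Qed.

(** At a point this is the sum of the squared coordinates of its projection to the (-1)-eigenspace
    of the involution in [H 1]. On C^n the squares are taken without conjugation, so negative values
    occur. *)
Definition sq_dist : {mpoly R[n]} :=
  \sum_(i < n) ('X_i - reynolds rG T 'X_i) ^+ 2.

Definition avg_sq_dist := reynolds rG P sq_dist.

Lemma evalC_sq_dist u x : u \in P -> #[u]%g = 2%N ->
  evalC x sq_dist = \sum_(i < n) ((x i 0 - actC u x i 0) / 2) ^+ 2.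
Proof.
move=> uP ou; rewrite rmorph_sum; apply: eq_bigr => i _ /=.
rewrite rmorphXn rmorphB /= evalCX evalC_reynolds // oT (chain_bottomE uP ou).
rewrite big_setU1 ?inE ?big_set1; last first.
  by apply: contra_eqN ou => /eqP <-; rewrite order1.
rewrite invg1 actC1 !evalCX.
have -> : u^-1%g = u.
  by apply/eqP; rewrite eq_invg_mul -[(u * u)%g]/(u ^+ 2)%g -ou expg_order.
rewrite /= fmorphV rmorph_nat; congr (_ ^+ 2).
by field.
Qed.

Lemma evalC_avg_sq_dist x : evalC x avg_sq_dist =
  (#|P|%:R)^-1 * \sum_(h in P) evalC (actC h^-1%g x) sq_dist.
Proof. by rewrite evalC_reynolds //= fmorphV rmorph_nat. Qed.

(** The conjugate [u ^ h] is again an involution of [P]. Centrality lets a relation between [y] and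
    [actC u y] pass to every translate in the average over [P]. *)
Lemma involution_comm u h : u \in P -> #[u]%g = 2%N -> h \in P -> (u * h = h * u)%g.
Proof.
move=> uP ou hP; rewrite conjgC; congr (_ * _)%g.
by apply: (Sylow_involution_unique maxE2 sylP); rewrite ?groupJ ?orderJ.
Qed.

Lemma actC_involution_comm u h y : u \in P -> #[u]%g = 2%N -> h \in P ->
  actC u (actC h y) = actC h (actC u y).
Proof.
move=> uP ou hP.
by rewrite -!actCM ?(subsetP sPG) // involution_comm.
Qed.

Lemma conjc_fixed (z : C) : conj z = z -> z = toC (complex.Re z).
Proof. by case: z => a b [] /eqP; rewrite eqNr => /eqP ->. Qed.

Lemma sq_term_ge0 u x i :
  map_mx conj x = x -> 0 <= ((x i 0 - actC u x i 0) / 2) ^+ 2.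
Proof.
move=> xr; set d := _ / 2; suff /conjc_fixed -> : conj d = d.
  by rewrite -rmorphXn ler0c sqr_ge0.
have fixr z : map_mx conj z = z -> conj (z i 0) = z i 0.
  by move/matrixP/(_ i 0); rewrite mxE.
have -> : conj d = (conj (x i 0) - conj (actC u x i 0)) / 2.
  by rewrite /d rmorphM rmorphB fmorphV rmorph_nat.
by rewrite !fixr // -?actC_conj xr.
Qed.

Lemma avg_sq_dist_ge0 y : map_mx conj y = y -> 0 <= evalC y avg_sq_dist.
Proof.
move=> yr; have [u uP ou] := exists_involution.
rewrite evalC_avg_sq_dist mulr_ge0 ?invr_ge0 ?ler0n //; apply: sumr_ge0 => h hP.
rewrite (evalC_sq_dist _ uP ou); apply: sumr_ge0 => i _.
by apply: sq_term_ge0; rewrite -actC_conj yr.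
Qed.

(** Each translate [z] of [y] by [P] also satisfies [conj z = u z], so the terms are squares of the
    purely imaginary numbers [(z_i - conj z_i) / 2]. *)
Lemma avg_sq_dist_le0 u y : u \in P -> #[u]%g = 2%N ->
  map_mx conj y = actC u y -> evalC y avg_sq_dist <= 0.
Proof.
move=> uP ou yu; rewrite evalC_avg_sq_dist -oppr_ge0 -mulrN -sumrN.
rewrite mulr_ge0 ?invr_ge0 ?ler0n //; apply: sumr_ge0 => h hP.
rewrite (evalC_sq_dist _ uP ou) actC_involution_comm ?groupV // -yu actC_conj.
rewrite -sumrN; apply: sumr_ge0 => i _.
rewrite [X in _ - X]mxE subcJ; set b := complex.Im _.
have -> : 2%:R * toC b * 'i%C / 2 = toC b * 'i%C :> C by field.
by rewrite exprMn sqr_i mulrN1 opprK -rmorphXn ler0c sqr_ge0.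
Qed.

Lemma avg_sq_dist_eq0 u y : u \in P -> #[u]%g = 2%N ->
  actC u y = y -> evalC y avg_sq_dist = 0.
Proof.
move=> uP ou yu; rewrite evalC_avg_sq_dist big1 ?mulr0 // => h hP.
rewrite (evalC_sq_dist _ uP ou) actC_involution_comm ?groupV // yu.
by rewrite big1 // => i _; rewrite subrr mul0r expr0n.
Qed.

Lemma avg_sq_dist_neq0 : avg_sq_dist != 0.
Proof.
have [u uP ou] := exists_involution; have uG := subsetP sPG _ uP.
have rGu : rG u != 1%:M.
  apply: contra_eqN ou => /eqP rGu.
  have /(subsetP faithG) : u \in rker rG by apply/rkerP.
  by rewrite inE => /eqP ->; rewrite order1.
have [j [i uij]] : exists j i, (rG u) i j != (1%:M : 'M[R]_n) i j.
  apply: contrapT => nex; case/eqP: rGu; apply/matrixP => i j.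
  by apply: contrapT => /eqP ne; apply: nex; exists j, i.
(* A basis vector moved by [u], which exists by faithfulness. At this real point all terms are
   nonnegative, and the one for [h = 1] and coordinate [i] is not zero. *)
pose y : 'cV[C]_n := \col_k toC (k == j)%:R.
have yr : map_mx conj y = y by apply/colP => k; rewrite !mxE conjc_real.
have actj i' : actC u y i' 0 = toC (rG u i' j).
  rewrite mxE (bigD1 j) //= big1 ?addr0 => [|k kj]; first by rewrite !mxE eqxx mulr1.
  by rewrite !mxE (negbTE kj) rmorph0 mulr0.
apply: contraTneq isT => F0.
have /eqP : evalC y avg_sq_dist = 0 by rewrite F0 rmorph0.
rewrite evalC_avg_sq_dist mulf_eq0 invr_eq0 pnatr_eq0 -leqn0 leqNgt cardG_gt0 /=.
rewrite psumr_eq0 => [/allP/(_ 1%g)|h hP]; last first.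
  rewrite (evalC_sq_dist _ uP ou); apply: sumr_ge0 => k _; apply: sq_term_ge0.
  by rewrite -actC_conj yr.
rewrite mem_index_enum group1 /= invg1 actC1 => /(_ isT).
rewrite (evalC_sq_dist _ uP ou) psumr_eq0 => [/allP/(_ i)|k _]; last exact: sq_term_ge0.
rewrite mem_index_enum /= => /(_ isT).
rewrite expf_eq0 /= mulf_eq0 invr_eq0 pnatr_eq0 orbF subr_eq0 actj mxE.
by move=> /eqP/complexI uijE; case/eqP: uij; rewrite -uijE mxE.
Qed.

Lemma mact_repr_lcoset s :
  s \in G -> mact (repr (s *: P)%g) avg_sq_dist = mact s avg_sq_dist.
Proof.
move=> sG; have /lcosetP[h hP ->] := mem_repr s (lcoset_refl P s).
by rewrite mactM ?(subsetP sPG h hP) // mact_reynolds.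
Qed.

Lemma mem_lcosets_mul t D : t \in G -> ((t *: D)%g \in lcosets P G) = (D \in lcosets P G).
Proof.
move=> tG; apply/lcosetsP/lcosetsP => -[s sG sE]; last first.
  by exists (t * s)%g; rewrite ?groupM // sE lcosetM.
by exists (t^-1 * s)%g; rewrite ?groupM ?groupV // lcosetM -sE lcosetK.
Qed.

Lemma chain_poly_invariant : g_invariant rG (chain_poly rG H l).
Proof.
move=> t tG; rewrite /chain_poly rmorph_prod [RHS](reindex_inj (@lcoset_inj gT t)) /=.
apply: eq_big => [D|D /lcosetsP[s sG ->]]; first by rewrite mem_lcosets_mul.
by rewrite -lcosetM -!/avg_sq_dist !mact_repr_lcoset ?groupM // mactM.
Qed.

Lemma chain_poly_neq0 : chain_poly rG H l != 0.
Proof.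
rewrite /chain_poly prodf_seq_neq0; apply/allP => D _; apply/implyP.
move=> /lcosetsP[s sG ->]; rewrite -/sq_dist -/avg_sq_dist mact_repr_lcoset //.
apply: contraNneq avg_sq_dist_neq0 => /(congr1 (mact s^-1)%g).
by rewrite rmorph0 -mactM ?groupV // mulVg mact1 => ->.
Qed.

Definition coset_value x (D : {set gT}) : C := evalC x (mact (repr D) avg_sq_dist).

Lemma evalC_chain_poly x :
  evalC x (chain_poly rG H l) = \prod_(D in lcosets P G) coset_value x D.
Proof. by rewrite rmorph_prod. Qed.

Lemma coset_valueE x s : s \in G ->
  coset_value x (s *: P)%g = evalC (actC s^-1%g x) avg_sq_dist.
Proof. by move=> sG; rewrite /coset_value mact_repr_lcoset // evalC_mact. Qed.

Lemma chain_poly_ge0 x : map_mx conj x = x -> 0 <= evalC x (chain_poly rG H l).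
Proof.
move=> xr; rewrite evalC_chain_poly; apply: prodr_ge0 => _ /lcosetsP[s sG ->].
by rewrite coset_valueE // avg_sq_dist_ge0 // -actC_conj xr.
Qed.

Lemma chain_poly_fixed x r : r \in G -> #[r]%g = 2%N -> actC r x = x ->
  evalC x (chain_poly rG H l) = 0.
Proof.
(* The coset [s P] is stable under [r], and [r ^ s] fixes [s^-1 x], so its factor vanishes. *)
move=> rG' or rx; have [s sG rsP] := involution_conj_Sylow sylP rG' or.
rewrite evalC_chain_poly (bigD1 (s *: P)%g) /=; last by apply/lcosetsP; exists s.
apply/eqP; rewrite mulf_eq0; apply/orP; left; apply/eqP.
rewrite coset_valueE // (@avg_sq_dist_eq0 (r ^ s)%g) ?orderJ //.
by rewrite -actCM ?groupJ ?groupV // conjgE -!mulgA mulgV mulg1 actCM ?groupV // rx.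
Qed.

Lemma chain_poly_le0 x r : r \in G -> #[r]%g = 2%N -> map_mx conj x = actC r x ->
  evalC x (chain_poly rG H l) <= 0.
Proof.
move=> rG' or rx; rewrite evalC_chain_poly.
have rr : (r * r = 1)%g by rewrite -[(r * r)%g]/(r ^+ 2)%g -or expg_order.
rewrite -oppr_ge0 -mulN1r.
(* The number of cosets is the index of a Sylow 2-subgroup. *)
have odd_cosets : odd #|lcosets P G|.
  by rewrite card_lcosets odd_2'nat; case/and3P: sylP.
have <- : (-1) ^+ #|lcosets P G| = -1 :> C by rewrite -signr_odd odd_cosets.
apply: (@paired_prod_sign R _ _ (fun D => (r *: D)%g)) => D.
- by rewrite mem_lcosets_mul.
- by rewrite -lcosetM rr lcoset1.
- move=> /lcosetsP[s sG ->]; rewrite -lcosetM !coset_valueE ?groupM //.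
  rewrite -evalC_conj -actC_conj rx -actCM ?groupV // invMg.
  suff -> : (r^-1 = r)%g by [].
  by apply/eqP; rewrite eq_invg_mul rr.
(* If [r] fixes the coset [s P], then [r ^ s] is an involution of [P] sending [s^-1 x] to its
   conjugate. *)
move=> /lcosetsP[s sG ->]; rewrite -lcosetM coset_valueE // => rsP.
have rsP' : (r ^ s)%g \in P.
  by rewrite conjgE -mem_lcoset -rsP lcoset_refl.
apply: (@avg_sq_dist_le0 (r ^ s)%g) => //; first by rewrite orderJ.
rewrite -actC_conj rx -!actCM ?groupJ ?groupV //.
by rewrite conjgE -!mulgA mulgV mulg1.
Qed.

Lemma chain_poly_gt0_real x s : s \in G -> map_mx conj x = actC s x ->
  0 < evalC x (chain_poly rG H l) -> map_mx conj x = x.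
Proof.
move=> sG xs gpos.
have conjK : map_mx conj (map_mx conj x) = x by apply/colP => i; rewrite !mxE conjcK.
(* The matrices are real, so [s] also sends the conjugate of [x] back to [x]. *)
have sk k : actC (s ^+ k)%g x = if odd k then map_mx conj x else x.
  elim: k => [|k IH]; first by rewrite expg0 actC1.
  by rewrite expgS actCM ?groupX // IH /=; case: (odd k); rewrite //= actC_conj -xs.
(* If [s] has even order, its power of order 2 maps [x] either to its conjugate
   or to itself. *)
have [oddo|evo] := boolP (odd #[s]%g).
  by have := sk #[s]%g; rewrite oddo expg_order actC1.
have oE : #[s]%g = (#[s]%g./2 * 2)%N by rewrite muln2 -[LHS]odd_double_half (negbTE evo).
have oh : #[s ^+ #[s]%g./2]%g = 2%N.
  rewrite orderXdiv; last by rewrite {2}oE dvdn_mulr.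
  by rewrite {1}oE mulKn // -(ltn_pmul2r (ltn0Sn 1)) -oE order_gt0.
have := sk #[s]%g./2; case: (odd _) => skh.
  by have := @chain_poly_le0 x _ (groupX _ sG) oh (esym skh); rewrite (lt_geF gpos).
by have := chain_poly_fixed (groupX _ sG) oh skh => g0; rewrite g0 ltxx in gpos.
Qed.

(** * From the real zero set to the Hilbert image *)

Variables (m : nat) (pi : 'I_m -> {mpoly R[n]}).
Hypothesis piF : fundamental_invariants rG pi.

Lemma meval_subst_inv p v : (subst_inv pi p).@[v] = p.@[hilbert_map pi v].
Proof. by rewrite comp_mpoly_meval; apply: meval_eq => i; rewrite tnth_mktuple. Qed.

Lemma hilbert_image_zero_set z : hilbert_image pi z -> real_zero_set pi z.
Proof.
by move=> [x ->] p p0; rewrite -meval_subst_inv p0 meval0.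
Qed.

Lemma zero_set_lift z : real_zero_set pi z ->
  exists x, forall p, evalC x (subst_inv pi p) = toC p.@[z].
Proof.
move=> zV; have [pi_inv [_ pi_gen]] := piF.
have wd p q : subst_inv pi p = subst_inv pi q -> p.@[z] = q.@[z].
  move=> pq; apply/eqP; rewrite -subr_eq0 -mevalB; apply/eqP/zV.
  by rewrite /rel_ideal /subst_inv comp_mpolyB; apply/eqP; rewrite subr_eq0; apply/eqP.
have inv_subst p : g_invariant rG (subst_inv pi p).
  move=> s sG; apply: evalC_inj => x; rewrite evalC_mact // /subst_inv.
  apply: (@mpoly_rmorph_eq _ _ _ (evalC _ \o comp_mpoly _)
    (evalC x \o comp_mpoly _)) => [c|i] /=.
    by rewrite comp_mpolyC !evalCC.
  by rewrite comp_mpolyXU -tnth_nth tnth_mktuple -evalC_mact // pi_inv.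
(* Makes [phi_z] a total function; on polynomials that are not invariant its value is arbitrary. On
   invariants [wd] removes the dependence on the chosen [w f]. *)
have /boolp.choice[w wP] : forall f, exists p, g_invariant rG f -> f = subst_inv pi p.
  move=> f; have [/pi_gen[p fE]|ninv] := pselect (g_invariant rG f); first by exists p.
  by exists 0 => /ninv.
pose phi f := (w f).@[z].
have phiE p : phi (subst_inv pi p) = p.@[z] by apply: wd; rewrite -wP.
have [|||x xP] := @lift_point R gT G n rG phi.
- by move=> c; rewrite -[RHS](mevalC z) -phiE /subst_inv comp_mpolyC.
- move=> f h /pi_gen[p ->] /pi_gen[q ->].
  by rewrite !phiE -mevalD -phiE /subst_inv comp_mpolyD.
- move=> f h /pi_gen[p ->] /pi_gen[q ->].
  by rewrite !phiE -mevalM -phiE /subst_inv rmorphM.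
by exists x => p; rewrite xP ?phiE.
Qed.

Lemma chain_poly_pos_image z : real_zero_set pi z ->
  phi_pos pi z (chain_poly rG H l) -> hilbert_image pi z.
Proof.
move=> zV [p [gE pz]]; have [x xP] := zero_set_lift zV.
have [_ [_ pi_gen]] := piF.
(* All invariants take real values at [x], hence the same values at its conjugate. *)
have [s sG xs] : exists2 s, s \in G & map_mx conj x = actC s x.
  apply: orbit_separation => f /pi_gen[q ->].
  by rewrite evalC_conj xP conjc_real.
have xr : map_mx conj x = x.
  by apply: (chain_poly_gt0_real sG xs); rewrite gE xP ltcR.
pose v i := complex.Re (x i 0).
have xE : x = \col_i toC (v i).
  apply/colP => i; rewrite mxE; apply: conjc_fixed.
  by move/matrixP/(_ i 0): xr; rewrite mxE.
exists v; apply: funext => i; apply: (@complexI R).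
rewrite /hilbert_map -evalC_real -xE.
have -> : pi i = subst_inv pi 'X_i.
  by rewrite /subst_inv comp_mpolyXU -tnth_nth tnth_mktuple.
by rewrite xP mevalXU.
Qed.

Lemma chain_poly_described : generically_described pi [:: chain_poly rG H l].
Proof.
have [_ [_ pi_gen]] := piF.
pose g := chain_poly rG H l.
(* The exceptional set is where positivity fails on the image. As [g] is nonnegative at real points,
   any [p] representing it vanishes there. *)
exists (fun z => hilbert_image pi z /\ ~ phi_pos pi z g); split=> [z|].
  split=> [zi|[[zV gpos]|[//]]].
    have [gz|ngz] := pselect (phi_pos pi z g); last by right.
    left; split; first exact: hilbert_image_zero_set.
    by move=> f; rewrite inE => /eqP ->.
  by apply: chain_poly_pos_image => //; apply: gpos; rewrite inE.
have [p gE] := pi_gen _ chain_poly_invariant.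
apply: (@dim_lt_vanishing _ _ _ _ _ p); first by rewrite -gE chain_poly_neq0.
  by move=> z [].
move=> z [[x zx] ngz].
have pzE : p.@[z] = g.@[x].
  by rewrite /g gE zx meval_subst_inv.
have: 0 <= p.@[z].
  rewrite pzE -lecR -evalC_real chain_poly_ge0 //.
  by apply/colP => i; rewrite !mxE conjc_real.
rewrite le_eqVlt => /orP[/eqP // |pz]; case: ngz; exists p; split=> //.
Qed.

End ChainPoly.

Theorem theorem3p11 (R : realType) (gT : finGroupType) (G : {group gT}) (n : nat)
    (rG : mx_representation R G n) (m : nat) (pi : 'I_m -> {mpoly R[n]}) :
  mx_faithful rG ->
  fundamental_invariants rG pi ->
  (forall E : {group gT}, E \in ('E*_2(G))%g -> #|E| = 2%N) ->
  (exists2 g : {mpoly R[n]}, g_invariant rG g & generically_described pi [:: g]) /\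
  (forall (q l : nat) (H : nat -> {group gT}),
     odd q -> #|G| = (q * 2 ^ l)%N ->
     (forall i, (1 <= i <= l)%N -> #|H i| = (2 ^ i)%N) ->
     (forall i, (1 <= i < l)%N -> H i \subset H i.+1) ->
     H l \subset G ->
     generically_described pi [:: chain_poly rG H l]).
Proof.
move=> faithG piF maxE2.
(* The trivial group lies in some maximal elementary abelian 2-subgroup, of order 2 by hypothesis;
   thus [G] has even order. *)
have [E0 maxE0] : exists E, E \in ('E*_2(G))%g.
  have E1 : 1%G \in ('E_2(G))%g by apply/pElemP; rewrite sub1G abelem1.
  by have [E maxE _] := pmaxElem_exists E1; exists E.
have oE0 := maxE2 _ maxE0.
have [sE0G abE0] : E0 \subset G /\ (2.-abelem E0)%g.
  by apply/pElemP; case/pmaxElemP: maxE0.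
split.
  have [P sylP sE0P] := Sylow_superset sE0G (abelem_pgroup abE0).
  (* [chain_poly rG H 2] reads [H] at 1 and 2, giving the pair [E0], [P]. The index 2 is a label:
     [P] is a full Sylow subgroup of any order. *)
  pose H i := if i == 1%N then E0 else P.
  exists (chain_poly rG H 2); first exact: chain_poly_invariant.
  exact: chain_poly_described.
move=> q l H oddq oG oH sH sHlG.
have l_gt0 : (0 < l)%N.
  rewrite lt0n; apply/eqP => l0; have := cardSg sE0G.
  by rewrite oE0 oG l0 muln1 dvdn2 oddq.
have oHl : #|H l| = (2 ^ l)%N by rewrite oH // l_gt0 leqnn.
(* As [q] is odd, [2 ^ l] is the full 2-part of the order of [G]. *)
have sylH : 2.-Sylow(G)%g (H l).
  rewrite pHallE sHlG oHl oG p_part lognM ?expn_gt0 ?(odd_gt0 oddq) //.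
  by rewrite pfactorK // logn_coprime ?coprime2n // add0n eqxx.
apply: (chain_poly_described faithG maxE2 sylH _ _ piF).
  by rewrite oH ?l_gt0.
have sub1 k : (k < l)%N -> H 1%N \subset H k.+1.
  elim: k => [//|k IH] lk; apply: subset_trans (IH (ltnW lk)) _.
  by apply: sH.
by have := sub1 l.-1; rewrite prednK // => /(_ (leqnn _)).
Qed.
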